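(* Let $X$ be a real Banach space, $K\subset X$ a nonempty convex weakly compact set, and $f:K\times K\to\mathbb{R}$ a bifunction with $f\in\overline{\mathcal{Q}}(K)$. If $f_{\overline{q}}$ is properly quasimonotone, then $\operatorname{CFP}(f_{\overline{q}},K)$ is nonempty. Moreover, if in addition $f_{\overline{q}}$ has the upper sign property on $K$, then $\operatorname{EP}(f,K)$ is nonempty.
   Context: For $h:X\to[-\infty,+\infty]$ and $\lambda\in\mathbb{R}$ let $S_\lambda(h)=\{x\in X:h(x)\le\lambda\}$. The lower semicontinuous quasiconvex regularization of $h$ is $h_{\overline{q}}(x)=\inf\{\lambda\in\mathbb{R}:x\in\overline{\mathrm{co}}(S_\lambda(h))\}$ (with $\inf\emptyset=+\infty$), where $\overline{\mathrm{co}}$ is the norm-closed convex hull. For $f:K\times K\to\mathbb{R}$ and $x\in K$, extend $f(x,\cdot)$ to $X$ by $+\infty$ outside $K$ and put $f_{\overline{q}}(x,\cdot)=(f(x,\cdot))_{\overline{q}}$, regarded as a function on $K$. $\overline{\mathcal{Q}}(K)$ is the family of bifunctions $f:K\times K\to\mathbb{R}$ such that $f_{\overline{q}}(x,y)\in\mathbb{R}$ for all $x,y\in K$. A bifunction $g:K\times K\to\mathbb{R}$ is properly quasimonotone if for all $x_1,\dots,x_n\in K$ and all $x\in\mathrm{co}(\{x_1,\dots,x_n\})$ there is $i\in\{1,\dots,n\}$ with $g(x_i,x)\le0$. $g$ has the upper sign property on $K$ if for every $x\in K$ and every $y\in K$: if $g(x_t,x)\le0$ for all $t\in\,]0,1[$,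 where $x_t=(1-t)x+ty$, then $g(x,y)\ge0$. $\operatorname{EP}(g,K)=\{x\in K:g(x,y)\ge0\text{ for all }y\in K\}$ and $\operatorname{CFP}(g,K)=\{x\in K:g(y,x)\le0\text{ for all }y\in K\}$. *)

(* Defs.v *)
From HB Require Import structures.
From mathcomp Require Import all_boot all_order all_algebra.
From mathcomp Require Import all_classical all_reals all_analysis.

Set Implicit Arguments.
Unset Strict Implicit.
Unset Printing Implicit Defensive.

Import Order.TTheory GRing.Theory Num.Theory.
Import numFieldNormedType.Exports.

Local Open Scope classical_set_scope.
Local Open Scope ring_scope.

Definition topological_dual (R : realType) (X : normedModType R) : Type :=
  {phi : {linear X -> R^o} | continuous phi}.

(* The carrier X with the coarsest topology making every element of the
   topological dual continuous. *)
Definition weak_space (R : realType) (X : normedModType R) : Type :=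
  sup_topology (fun phi : topological_dual X =>
    Topological.class (initial_topology (sval phi : X -> R^o))).

HB.instance Definition _ (R : realType) (X : normedModType R) :=
  Topological.on (weak_space X).

Definition weakly_compact (R : realType) (X : normedModType R) (K : set X) :=
  compact (K : set (weak_space X)).

Definition convex_hull (R : realType) (X : normedModType R) (A : set X) :
  set X := smallest (@convex_set R X) A.

Definition closed_convex_hull (R : realType) (X : normedModType R)
  (A : set X) : set X := closure (convex_hull A).

Definition sublevel (R : realType) (X : normedModType R) (h : X -> \bar R)
  (lambda : R) : set X := [set x | (h x <= lambda%:E)%E].

Definition lsc_quasiconvex_reg (R : realType) (X : normedModType R)
    (h : X -> \bar R) (x : X) : \bar R :=
  ereal_inf [set lambda%:E | lambda in
    [set lambda : R | closed_convex_hull (sublevel h lambda) x]].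

(* A bifunction K x K -> R is represented by a total function X -> X -> R;
   nothing below depends on its values outside K x K. *)

Definition extend_pinfty (R : realType) (X : normedModType R) (K : set X)
  (h : X -> R) (y : X) : \bar R := if y \in K then (h y)%:E else +oo%E.

Definition bifun_ereg (R : realType) (X : normedModType R) (K : set X)
  (f : X -> X -> R) (x y : X) : \bar R :=
  lsc_quasiconvex_reg (extend_pinfty K (f x)) y.

Definition regularizable (R : realType) (X : normedModType R) (K : set X)
    (f : X -> X -> R) : Prop :=
  forall x y, K x -> K y -> bifun_ereg K f x y \is a fin_num.

(* The regularization as a real bifunction; since [fine] sends infinite values
   to 0, this is meaningful only for [regularizable] bifunctions. *)
Definition bifun_reg (R : realType) (X : normedModType R) (K : set X)
  (f : X -> X -> R) (x y : X) : R := fine (bifun_ereg K f x y).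

Definition properly_quasimonotone (R : realType) (X : normedModType R)
    (K : set X) (g : X -> X -> R) : Prop :=
  forall (n : nat) (x : 'I_n -> X), (forall i, K (x i)) ->
  forall z, convex_hull (range x) z -> exists i, g (x i) z <= 0.

Definition upper_sign_property (R : realType) (X : normedModType R)
    (K : set X) (g : X -> X -> R) : Prop :=
  forall x y, K x -> K y ->
  (forall t : R, 0 < t < 1 -> g ((1 - t) *: x + t *: y) x <= 0) ->
  0 <= g x y.

Definition EP (R : realType) (X : normedModType R) (g : X -> X -> R)
  (K : set X) : set X := [set x | K x /\ forall y, K y -> 0 <= g x y].

Definition CFP (R : realType) (X : normedModType R) (g : X -> X -> R)
  (K : set X) : set X := [set x | K x /\ forall y, K y -> g y x <= 0].

(* Main.v *)
From HB Require Import structures.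
Require Import Defs.
From mathcomp Require Import all_boot all_order all_algebra.
From mathcomp Require Import all_classical all_reals all_analysis.
From mathcomp Require Import lra.

Set Implicit Arguments.
Unset Strict Implicit.
Unset Printing Implicit Defensive.

Import Order.TTheory GRing.Theory Num.Theory.
Import numFieldNormedType.Exports.

Local Open Scope classical_set_scope.
Local Open Scope ring_scope.

(** Write [M y] for the set of points [x] with [bifun_reg K f y x <= 0]; inside
    [K] it is an intersection of closed convex hulls of sublevel sets, hence
    closed and convex ([nonpos_regionP]).  A point common to [K] and all the
    [M y], [y] in [K], is exactly a point of [CFP].  Proper quasimonotonicity says
    that the convex hull of finitely many points [y_i] of [K] is covered by the
    [M y_i], which is the hypothesis of the Knaster-Kuratowski-Mazurkiewicz
    theorem, so finitely many [M y_i] always meet in [K] ([convex_kkm]).  Closed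
    convex sets are weakly closed ([weakly_closed_convex]), so weak compactness of
    [K] makes all the [M y] meet ([weakly_compact_bigcap]).

    Since the [M y] are convex, the KKM theorem needs no fixed point theorem: it
    follows by induction from Berge's theorem ([berge_intersection]), where closed
    convex sets that cover a nonempty weakly compact convex set [K], and of which
    all but any one meet in [K], all meet in [K].  If they did not, a closed
    hyperplane would separate one of the sets from the intersection of the others
    inside [K]; on the slice of [K] by this hyperplane the others satisfy the same
    hypotheses, but do not meet.

    Both the weak closedness and the separation come from one form of the
    Hahn-Banach theorem, due to Mazur and Orlicz: a sublinear [p] that is at least
    [r] on a convex set [C] dominates a linear form with the same property
    ([mazur_orlicz]).  For [p] the norm this separates [C] from the origin by a
    continuous linear form.

    The second claim follows because the points [(1 - t) x + t y] of a segment in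
    [K] are legitimate first arguments: [CFP] is contained in [EP] under the upper
    sign property, and the regularization lies below [f] on [K]. *)

Lemma convex_setP (R : realType) (V : lmodType R) (A : set V) :
  @convex_set R V A <->
  (forall t x y, 0 <= t <= 1 -> A x -> A y -> A (t *: x + (1 - t) *: y)).
Proof.
split=> [cA t x y /andP[t0 t1] Ax Ay|cA x y l].
  have := cA x y (Itv01 t0 t1); rewrite !inE; exact.
rewrite !inE => Ax Ay.
by apply: cA => //; apply/andP; split; [exact: ge0|exact: le1].
Qed.

(** * Linear forms dominated by a sublinear function *)

Section sublinear.
Variables (R : realType) (V : lmodType R).
Implicit Types (q : V -> R) (C : set V) (r : R).

Definition sublinear q :=
  (forall x y, q (x + y) <= q x + q y) /\
  (forall t x, 0 <= t -> q (t *: x) <= t * q x).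

Lemma sublinear0 q : sublinear q -> q 0 = 0.
Proof.
move=> [qD qZ]; apply/eqP; rewrite eq_le; apply/andP; split.
  by have := qZ 0 0 (lexx 0); rewrite scale0r mul0r.
by have := qD 0 0; rewrite addr0; lra.
Qed.

Lemma sublinearN_le q x : sublinear q -> - q (- x) <= q x.
Proof.
by move=> sq; have := sq.1 x (- x); rewrite subrr sublinear0//; lra.
Qed.

Definition lowered_set q C r (x : V) : set R :=
  [set s | exists t c, [/\ 0 <= t, C c & s = q (x + t *: c) - t * r]].

(** When [C] is convex and [q] is at least [r] on it, this is the largest
    sublinear function below [q] whose value at [- c] is at most [- r] for all [c]
    in [C].  A linear form below it is thus below [q] and at least [r] on [C]. *)
Definition lowered q C r (x : V) : R := inf (lowered_set q C r x).

Section lowered.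
Variables (q : V -> R) (C : set V) (r : R).
Hypotheses (sq : sublinear q) (cC : @convex_set R V C) (C0 : C !=set0).
Hypothesis (rC : forall c, C c -> r <= q c).

(** This is where [r <= q] on [C] enters: without it the infimum defining
    [lowered] could be infinite, as [q (t c) - t r] could tend to minus infinity
    with [t]. *)
Lemma lowered_set_lbound x : lbound (lowered_set q C r x) (- q (- x)).
Proof.
move=> _ [t [c [t0 Cc ->]]].
have qtc : t * r <= q (t *: c).
  have [->|tn0] := eqVneq t 0; first by rewrite mul0r scale0r sublinear0.
  have tp : 0 < t by rewrite lt_neqAle eq_sym tn0.
  have := sq.2 t^-1 (t *: c); rewrite invr_ge0 => /(_ t0).
  rewrite scalerA mulVf// scale1r => qc.
  by rewrite -ler_pdivlMl//; exact: le_trans (rC Cc) qc.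
have := sq.1 (x + t *: c) (- x); rewrite addrAC subrr add0r; lra.
Qed.

Lemma lowered_le t c x : 0 <= t -> C c ->
  lowered q C r x <= q (x + t *: c) - t * r.
Proof.
move=> t0 Cc; apply: ge_inf.
  by exists (- q (- x)); exact: lowered_set_lbound.
by exists t, c.
Qed.

Lemma le_lowered a x :
  (forall t c, 0 <= t -> C c -> a <= q (x + t *: c) - t * r) ->
  a <= lowered q C r x.
Proof.
move=> aP; apply: lb_le_inf; last by move=> _ [t [c [t0 Cc ->]]]; exact: aP.
by have [c Cc] := C0; exists (q (x + 0 *: c) - 0 * r), 0, c.
Qed.

Lemma lowered_le_self x : lowered q C r x <= q x.
Proof.
have [c Cc] := C0.
by have := lowered_le x (lexx 0) Cc; rewrite scale0r addr0 mul0r subr0.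
Qed.

Lemma loweredN c : C c -> lowered q C r (- c) <= - r.
Proof.
move=> Cc; have := lowered_le (- c) ler01 Cc.
by rewrite scale1r addNr mul1r sublinear0// sub0r.
Qed.

(** Subadditivity uses convexity of [C]: [t c + s d] is [t + s] times the convex
    combination of [c] and [d] with weights proportional to [t] and [s]. *)
Lemma lowered_sublinear : sublinear (lowered q C r).
Proof.
split=> [x y|t x t0].
  suff H (t s : R) (c d : V) : 0 <= t -> 0 <= s -> C c -> C d ->
      lowered q C r (x + y) <=
      (q (x + t *: c) - t * r) + (q (y + s *: d) - s * r).
    rewrite -lerBlDr; apply: le_lowered => t c t0 Cc.
    rewrite lerBlDr -lerBlDl; apply: le_lowered => s d s0 Cd.
    by rewrite lerBlDl; exact: H.
  move=> t0 s0 Cc Cd.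
  have [e Ce tsE] : exists2 e, C e & t *: c + s *: d = (t + s) *: e.
    have [/eqP|tsn0] := eqVneq (t + s) 0.
      rewrite paddr_eq0// => /andP[/eqP-> /eqP->].
      by exists c => //; rewrite addr0 !scale0r addr0.
    have tsp : 0 < t + s by rewrite lt_neqAle eq_sym tsn0 addr_ge0.
    exists ((t / (t + s)) *: c + (1 - t / (t + s)) *: d).
      apply: (convex_setP C).1 => //; rewrite divr_ge0 ?addr_ge0//=.
      by rewrite ler_pdivrMr// mul1r lerDl.
    rewrite scalerDr !scalerA mulrCA divff// mulr1; congr (_ + _ *: _).
    by rewrite mulrBr mulr1 mulrCA divff// mulr1; lra.
  apply: le_trans (lowered_le _ (addr_ge0 t0 s0) Ce) _.
  rewrite -tsE [in q _]addrACA mulrDl.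
  by have := sq.1 (x + t *: c) (y + s *: d); lra.
have [->|tn0] := eqVneq t 0.
  rewrite mul0r scale0r; have := lowered_le_self 0.
  by rewrite (sublinear0 sq).
have tp : 0 < t by rewrite lt_neqAle eq_sym tn0.
rewrite -ler_pdivrMl//; apply: le_lowered => s c s0 Cc.
rewrite ler_pdivrMl//; apply: le_trans (lowered_le _ (mulr_ge0 t0 s0) Cc) _.
have := sq.2 t (x + s *: c) t0; rewrite scalerDr scalerA; lra.
Qed.

End lowered.

(** By Zorn's lemma: the pointwise infimum of a chain of sublinear functions below
    [p] is again sublinear, and finite because each [q] in the chain satisfies
    [q x >= - q (- x) >= - p (- x)]. *)
Lemma minimal_sublinear p : sublinear p ->
  exists q, [/\ sublinear q, forall x, q x <= p x &
    forall q', sublinear q' -> (forall x, q' x <= q x) -> q' = q].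
Proof.
move=> sp.
pose T := {q : V -> R | sublinear q /\ forall x, q x <= p x}.
pose below (u v : T) : bool := `[< forall x, sval v x <= sval u x >].
have [||u v /asboolP uv /asboolP vu|A totA|[q [sq qp]] qmin] := @Zorn T below.
- by move=> u; apply/asboolP => x.
- move=> v u w /asboolP uv /asboolP vw; apply/asboolP => x.
  exact: le_trans (vw x) (uv x).
- case: u v uv vu => [u pu] [v pv] /= uv vu; apply: eq_exist.
  by apply/funext => x; apply/eqP; rewrite eq_le uv vu.
- have [->|/set0P[u0 Au0]] := eqVneq A set0.
    by exists (exist _ p (conj sp (fun x => lexx _))).
  pose low x := inf [set sval u x | u in A].
  have has_lb x : has_lbound [set sval u x | u in A].
    exists (- p (- x)) => _ [u Au <-].
    apply: le_trans (sublinearN_le x (svalP u).1).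
    by rewrite lerN2; exact: (svalP u).2.
  have low_le u x : A u -> low x <= sval u x.
    by move=> Au; apply: ge_inf => //; exists u.
  have le_low a x : (forall u, A u -> a <= sval u x) -> a <= low x.
    move=> aP; apply: lb_le_inf; first by exists (sval u0 x), u0.
    by move=> _ [u Au <-]; exact: aP.
  have slow : sublinear low.
    split=> [x y|t x t0].
      rewrite -lerBlDr; apply: (le_low) => u Au.
      rewrite lerBlDr -lerBlDl; apply: (le_low) => v Av; rewrite lerBlDl.
      have [/asboolP uv|/asboolP vu] := totA _ _ Au Av.
        apply: le_trans (low_le v _ Av) _.
        by apply: le_trans ((svalP v).1.1 x y) _; rewrite lerD2r.
      apply: le_trans (low_le u _ Au) _.
      by apply: le_trans ((svalP u).1.1 x y) _; rewrite lerD2l.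
    have [->|tn0] := eqVneq t 0.
      rewrite mul0r; apply: le_trans (low_le u0 _ Au0) _.
      by rewrite scale0r (sublinear0 (svalP u0).1).
    have tp : 0 < t by rewrite lt_neqAle eq_sym tn0.
    rewrite -ler_pdivrMl//; apply: (le_low) => u Au; rewrite ler_pdivrMl//.
    exact: le_trans (low_le u _ Au) ((svalP u).1.2 t x t0).
  have lowp x : low x <= p x.
    exact: le_trans (low_le u0 x Au0) ((svalP u0).2 x).
  exists (exist _ low (conj slow lowp)) => u Au.
  by apply/asboolP => x /=; exact: low_le.
exists q; split=> // q' sq' q'q.
have q'p x : q' x <= p x by exact: le_trans (q'q x) (qp x).
have := qmin (exist _ q' (conj sq' q'p)).
by move=> /(_ (asboolT q'q)) /(congr1 sval).
Qed.

(** Lower [p] along [C], then take a minimal sublinear function [q] below the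
    result.  Minimality makes [q] linear: lowering [q] further along a singleton
    [y] at the level [q y] changes nothing, and this gives the missing inequality
    [q x + q y <= q (x + y)]. *)
Theorem mazur_orlicz p C r : sublinear p -> @convex_set R V C -> C !=set0 ->
  (forall c, C c -> r <= p c) ->
  exists phi : {linear V -> R^o},
    (forall x, phi x <= p x) /\ (forall c, C c -> r <= phi c).
Proof.
move=> sp cC C0 rC.
have sl := lowered_sublinear sp cC C0 rC.
have [q [sq ql qmin]] := minimal_sublinear sl.
have qD : {morph q : x y / x + y}.
  move=> x y; apply/eqP; rewrite eq_le sq.1/=.
  have cy : @convex_set R V [set y].
    by apply/convex_setP => t _ _ _ -> ->; rewrite -scalerDl subrKC scale1r.
  have y0 : [set y] !=set0 by exists y.
  have qy c : [set y] c -> q y <= q c by move=> ->.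
  have qE := qmin _ (lowered_sublinear sq cy y0 qy) (lowered_le_self sq y0 qy).
  rewrite -lerBrDr.
  by have := lowered_le sq qy x ler01 (erefl y); rewrite qE scale1r mul1r.
have qN x : q (- x) = - q x.
  by apply/eqP; rewrite -addr_eq0 -qD addNr sublinear0.
have qZ0 t x : 0 <= t -> q (t *: x) = t * q x.
  move=> t0; apply/eqP; rewrite eq_le sq.2//=.
  by have := sq.2 t (- x) t0; rewrite scalerN !qN mulrN lerN2.
have qlin : linear (q : V -> R^o).
  move=> t x y; rewrite qD; congr (_ + _).
  have [t0|t0] := leP 0 t; first exact: qZ0.
  rewrite -[in LHS](opprK t) scaleNr qN qZ0 ?oppr_ge0 ?ltW//.
  by rewrite mulNr opprK.
pose qL := GRing.isLinear.Build R V R^o *:%R q qlin.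
pose phi : {linear V -> R^o} := HB.pack q qL.
exists phi; split=> [x|c Cc].
  exact: le_trans (ql x) (lowered_le_self sp C0 rC x).
rewrite -lerN2 -[- phi c]qN.
exact: le_trans (ql _) (loweredN sp rC Cc).
Qed.

End sublinear.

(** * Weak topology and separation of convex sets *)

Section separation.
Variables (R : realType) (X : normedModType R).
Implicit Types (A B C K : set X).

Lemma convex_comb_lt (t u v e : R) :
  0 <= t <= 1 -> u < e -> v < e -> t * u + (1 - t) * v < e.
Proof.
move=> /andP[t0 t1] ue ve.
have [uv|/ltW vu] := leP u v.
  by have := ler_wpM2l t0 uv; lra.
by have := ler_wpM2l (_ : 0 <= 1 - t) vu; rewrite subr_ge0 => /(_ t1); lra.
Qed.

Lemma convex_comb_norm_lt (t e : R) (x y a b : X) : 0 <= t <= 1 ->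
  `|x - a| < e -> `|y - b| < e ->
  `|(t *: x + (1 - t) *: y) - (t *: a + (1 - t) *: b)| < e.
Proof.
move=> t01 xa yb; have /andP[t0 t1] := t01.
rewrite opprD addrACA -!scalerBr (le_lt_trans (ler_normD _ _))//.
by rewrite !normrZ !ger0_norm ?subr_ge0//; exact: convex_comb_lt.
Qed.

Lemma closure_normP A x :
  closure A x <-> forall e, 0 < e -> exists2 a, A a & `|x - a| < e.
Proof.
split=> [clA e e0|clA U /nbhs_ballP[e /= e0 eU]].
  have [a [Aa]] := clA _ (nbhsx_ballx x e e0).
  by rewrite -ball_normE /=; exists a.
have [a Aa xa] := clA e e0; exists a; split=> //; apply: eU.
by rewrite -ball_normE.
Qed.

Lemma convex_closure C : @convex_set R X C -> @convex_set R X (closure C).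
Proof.
move=> /convex_setP cC; apply/convex_setP => t x y t01.
move=> /closure_normP clx /closure_normP cly.
apply/closure_normP => e e0.
have [a Ca xa] := clx e e0; have [b Cb yb] := cly e e0.
exists (t *: a + (1 - t) *: b); first exact: cC.
exact: convex_comb_norm_lt.
Qed.

Lemma convex_setI A B :
  @convex_set R X A -> @convex_set R X B -> @convex_set R X (A `&` B).
Proof.
move=> /convex_setP cA /convex_setP cB.
apply/convex_setP => t x y t01 [Ax Bx] [Ay By].
by split; [exact: cA|exact: cB].
Qed.

Lemma convex_set_convex_hull A : @convex_set R X (convex_hull A).
Proof.
apply/convex_setP => t x y t01 hx hy C [cC AC].
by apply: (convex_setP C).1 => //; [apply: hx|apply: hy].
Qed.

(** The linear form given by Mazur-Orlicz for the norm is bounded by the norm,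
    hence continuous. *)
Lemma dual_separates_origin C r : @convex_set R X C -> C !=set0 ->
  (forall c, C c -> r <= `|c|) ->
  exists phi : topological_dual X, forall c, C c -> r <= sval phi c.
Proof.
move=> cC C0 rC.
have sn : sublinear (fun x : X => `|x|).
  split=> [x y|t x t0]; first exact: ler_normD.
  by rewrite normrZ ger0_norm.
have [phi [phin phir]] := mazur_orlicz sn cC C0 rC.
suff cphi : continuous phi by exists (exist _ phi cphi).
apply/linear_bounded_continuous/bounded_funP => a; exists a => x xa.
apply: le_trans xa; rewrite ler_norml phin andbT lerNl -linearN.
by rewrite -(normrN x).
Qed.

Lemma weak_continuous (phi : topological_dual X) :
  continuous (sval phi : weak_space X -> R^o).
Proof.
move=> x; apply: cvg_trans (@initial_continuous X R^o (sval phi) x).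
apply: cvg_app.
pose Tc (psi : topological_dual X) :=
  Topological.class (initial_topology (sval psi : X -> R^o)).
have FF : Filter (nbhs (x : weak_space X)) by exact: nbhs_filter.
exact: (@cvg_sup X (topological_dual X) Tc (nbhs (x : weak_space X)) x FF).1.
Qed.

(** Mazur's lemma.  A point [x] outside [C] has positive distance [e] to [C], so
    some continuous form is at least [e] on the translate of [C] by [- x]; the
    corresponding open half-space is a weak neighbourhood of [x] missing [C]. *)
Lemma weakly_closed_convex C :
  closed C -> @convex_set R X C -> closed (C : set (weak_space X)).
Proof.
move=> clC cC x wx; apply: contrapT => nCx.
have [e e0 eC] : exists2 e : R, 0 < e & forall c, C c -> e <= `|c - x|.
  apply: contrapT => ne; apply: nCx; apply: clC; apply/closure_normP => e e0.
  apply: contrapT => ne'; apply: ne; exists e => // c Cc.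
  rewrite leNgt; apply/negP => lte; apply: ne'.
    by exists c => //; rewrite distrC.
have cCx : @convex_set R X [set c - x | c in C].
  apply/convex_setP => t _ _ t01 [c Cc <-] [d Cd <-].
  exists (t *: c + (1 - t) *: d); first exact: (convex_setP C).1.
  by rewrite !scalerBr addrACA -opprD -scalerDl subrKC scale1r.
have Cx0 : [set c - x | c in C] !=set0.
  by have [c [Cc _]] := wx _ filterT; exists (c - x), c.
have [|phi phie] := dual_separates_origin (r := e) cCx Cx0.
  by move=> _ [c Cc <-]; exact: eC.
have : nbhs (x : weak_space X) [set y | sval phi y < sval phi x + e].
  apply: (@weak_continuous phi x [set y | y < sval phi x + e]).
  by apply: lt_nbhsl; rewrite ltrDl.
move=> /wx [c [Cc /=]]; apply/negP; rewrite -leNgt -lerBrDl -linearB.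
by apply: phie; exists c.
Qed.

Lemma weakly_compactI K C : weakly_compact K ->
  closed C -> @convex_set R X C -> weakly_compact (K `&` C).
Proof.
by move=> ? ? ?; apply: compact_closedI => //; exact: weakly_closed_convex.
Qed.

(* The characterization of compactness by families of closed sets is stated for
   pointed spaces. *)
HB.instance Definition _ := Pointed.on (weak_space X).

Lemma weakly_compact_bigcap K (I : choiceType) (M : I -> set X) :
  weakly_compact K ->
  (forall i, closed (M i)) -> (forall i, @convex_set R X (M i)) ->
  (forall s : seq I, exists2 x, K x & forall i, i \in s -> M i x) ->
  exists2 x, K x & forall i, M i x.
Proof.
move=> wK clM cM fip.
have [[i0 _]|I0] := pselect ([set: I] !=set0); last first.
  by have [x Kx _] := fip [::]; exists x => // i; case: I0; exists i.
have : \bigcap_(i in [set: I]) (K `&` M i) !=set0.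
  move: wK; rewrite /weakly_compact compact_In0; apply.
    by exists M => // i _; exact: weakly_closed_convex.
  move=> D _; have [x Kx xM] := fip (finmap.enum_fset D).
  by exists x => i Di; split=> //; exact: xM.
case=> x xM; exists x => [|i]; first by have [] := xM i0 Logic.I.
by have [] := xM i Logic.I.
Qed.

(** It suffices to bound the distance between [A] and [B] from below, and then to
    separate the convex set of differences from the origin.  If there were no such
    bound, [A] would meet each of the convex neighbourhoods [N n] of [B]; by weak
    compactness some point of [A] would lie in the closures of all of them, hence
    in the closed set [B]. *)
Lemma strict_separation A B : weakly_compact A -> @convex_set R X A ->
  A !=set0 -> closed B -> @convex_set R X B -> B !=set0 -> A `&` B = set0 ->
  exists (phi : topological_dual X) (a : R),
    (forall x, A x -> a < sval phi x) /\ (forall x, B x -> sval phi x < a).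
Proof.
move=> wA cA A0 clB cB B0 AB0.
have [r r0 rAB] : exists2 r : R, 0 < r &
    forall x y, A x -> B y -> r <= `|x - y|.
  apply: contrapT => nr.
  pose N (n : nat) := [set x | exists2 y, B y & `|x - y| < n.+1%:R^-1].
  have cN n : @convex_set R X (N n).
    apply/convex_setP => t x y t01 [a Ba xa] [b Bb yb].
    exists (t *: a + (1 - t) *: b); first exact: (convex_setP B).1.
    exact: convex_comb_norm_lt.
  have [//|n|n|s|x Ax xN] :=
    @weakly_compact_bigcap A nat (fun n => closure (N n)).
  - exact: closed_closure.
  - exact/convex_closure.
  (* The sets [N n] decrease, so finitely many of them contain the last one. *)
  - pose m := \max_(i <- s) i.
    have [x [y [Ax By xy]]] :
        exists x y, [/\ A x, B y & `|x - y| < m.+1%:R^-1].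
      apply: contrapT => nxy; apply: nr; exists m.+1%:R^-1 => // x y Ax By.
      by rewrite leNgt; apply/negP => lt_xy; apply: nxy; exists x, y.
    exists x => // i si; apply: subset_closure; exists y => //.
    apply: lt_le_trans xy _; rewrite lef_pV2 ?posrE// ler_nat ltnS.
    exact: leq_bigmax_seq.
  have Bx : B x.
    apply: clB; apply/closure_normP => e e0.
    have e20 : 0 < e / 2 by rewrite divr_gt0.
    have [n ne] : exists n : nat, n.+1%:R^-1 < e / 2.
      have [n _ /(_ n (leqnn n))] := near_infty_natSinv_lt (PosNum e20).
      by exists n.
    have [z [y By zy] xz] := (closure_normP _ _).1 (xN n) _ e20.
    exists y => //; rewrite -(subrKA z) (le_lt_trans (ler_normD _ _))//.
    by move: (lt_trans zy ne) xz; clear; move: (`|x - z|) (`|z - y|) => u v; lra.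
  by have : (A `&` B) x by []; rewrite AB0.
have cAB : @convex_set R X [set x - y | x in A & y in B].
  apply/convex_setP => t _ _ t01 [a Aa [b Bb <-]] [a' Aa' [b' Bb' <-]].
  exists (t *: a + (1 - t) *: a'); first exact: (convex_setP A).1.
  exists (t *: b + (1 - t) *: b'); first exact: (convex_setP B).1.
  by rewrite !scalerBr opprD addrACA.
have [a0 Aa0] := A0; have [b0 Bb0] := B0.
have AB_neq0 : [set x - y | x in A & y in B] !=set0.
  by exists (a0 - b0), a0 => //; exists b0.
have [|phi phir] := dual_separates_origin (r := r) cAB AB_neq0.
  by move=> _ [x Ax [y By <-]]; exact: rAB.
have phiAB x y : A x -> B y -> sval phi y <= sval phi x - r.
  move=> Ax By; rewrite lerBrDr addrC -lerBrDr -linearB.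
  by apply: phir; exists x => //; exists y.
have ubB x : A x -> ubound [set sval phi y | y in B] (sval phi x - r).
  by move=> Ax _ [y By <-]; exact: phiAB.
have phiB0 : [set sval phi y | y in B] !=set0 by exists (sval phi b0), b0.
(* The level lies half-way in the gap of width [r] above the supremum on [B]. *)
exists phi, (sup [set sval phi y | y in B] + r / 2); split=> x.
  move=> /ubB /(ge_sup phiB0); lra.
move=> Bx; have : sval phi x <= sup [set sval phi y | y in B].
  by apply: ub_le_sup; [exists (sval phi a0 - r); exact: ubB|exists x].
lra.
Qed.

End separation.

(** * Intersection theorems for closed convex sets *)

Section intersection_theorems.
Variables (R : realType) (X : normedModType R).
Implicit Types (K C : set X).

Lemma segment_meets_level (phi : topological_dual X) (a : R) (x y : X) :
  a < sval phi x -> sval phi y < a ->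
  exists2 t, 0 <= t <= 1 & sval phi (t *: x + (1 - t) *: y) = a.
Proof.
move=> ax ya; set u := sval phi x in ax *; set v := sval phi y in ya *.
have uv : 0 < u - v by rewrite subr_gt0; exact: lt_trans ax.
pose t := (a - v) / (u - v).
have tuv : t * (u - v) = a - v by rewrite divfK// gt_eqF.
exists t.
  apply/andP; split; first by rewrite divr_ge0// ltW// subr_gt0.
  by rewrite ler_pdivrMr// mul1r lerD2r ltW.
move: t tuv => t tuv; rewrite linearD !linearZ/= -/u -/v.
change (t * u + (1 - t) * v = a).
by rewrite mulrBl mul1r addrCA -mulrBr tuv subrKC.
Qed.

Lemma level_closed (phi : topological_dual X) (a : R) :
  closed [set x | sval phi x = a].
Proof.
apply: (@closed_comp X R^o (sval phi) [set a]) => [x _|].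
  exact: (svalP phi).
exact: closed_eq.
Qed.

Lemma level_convex (phi : topological_dual X) (a : R) :
  @convex_set R X [set x | sval phi x = a].
Proof.
apply/convex_setP => t x y _ /= xa ya.
by rewrite linearD !linearZ/= xa ya -scalerDl subrKC scale1r.
Qed.

(** Induction on the number of sets.  Suppose that the intersection [A] in [K] of
    all sets but [M i] misses [M i], and separate them by the hyperplane [H].  The
    slice [K `&` H] misses [M i], so the other sets cover it.  The
    intersection of all of them but [M j] contains a point of [A] and, by
    hypothesis, a point of [M i], both in [K] and on opposite sides of [H];
    therefore it meets the slice by convexity.
    The induction hypothesis then puts a point of [A] on [H]. *)
Theorem berge_intersection (I : eqType) (M : I -> set X) (s : seq I) K :
  weakly_compact K -> @convex_set R X K -> K !=set0 ->
  (forall i, closed (M i)) -> (forall i, @convex_set R X (M i)) -> uniq s ->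
  (forall x, K x -> exists2 i, i \in s & M i x) ->
  (forall i, i \in s -> exists2 x, K x &
     forall j, j \in s -> j != i -> M j x) ->
  exists2 x, K x & forall i, i \in s -> M i x.
Proof.
move=> + + + clM cM.
elim: s K => [|i s ih] K wK cK K0 us covK allbut1.
  by have [x Kx] := K0; have [] := covK x Kx.
have {us}[nis us] : i \notin s /\ uniq s by move: us => /= /andP.
apply: contrapT => nx.
pose A := K `&` \bigcap_(j in [set` s]) M j.
have clN : closed (\bigcap_(j in [set` s]) M j) by apply: closed_bigI => j _.
have cN : @convex_set R X (\bigcap_(j in [set` s]) M j).
  apply/convex_setP => t x y t01 xM yM j js.
  by apply: (convex_setP (M j)).1 => //; [exact: xM|exact: yM].
have A0 : A !=set0.
  have [x Kx xM] := allbut1 i (mem_head _ _).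
  exists x; split=> // j js; apply: xM; first by rewrite inE js orbT.
  by apply: contraNneq nis => <-.
have AM0 : A `&` M i = set0.
  apply/seteqP; split=> // x [[Kx xN] xi]; apply: nx; exists x => // j.
  by rewrite inE => /predU1P[->//|js]; exact: xN.
have [s0|[k ks]] : s = [::] \/ exists k, k \in s.
- by case: s {ih nis us covK allbut1 nx A clN cN A0 AM0} => [|k s];
    [left|right; exists k; rewrite mem_head].
- have [x [Kx _]] := A0; apply: nx; exists x => // j.
  by have [l] := covK x Kx; rewrite s0 !inE => /eqP-> Mix /eqP->.
have Mi0 : M i !=set0.
  have [x Kx xM] := allbut1 k (mem_behead (s := i :: s) ks).
  exists x; apply: xM; first exact: mem_head.
  by apply: contraNneq nis => ->.
have [phi [a [Aphi Mphi]]] := strict_separation (weakly_compactI wK clN cN)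
  (convex_setI cK cN) A0 (clM i) (cM i) Mi0 AM0.
pose H := [set x | sval phi x = a].
have crossH x y : A x -> K y -> M i y ->
    exists t, 0 <= t <= 1 /\ (K `&` H) (t *: x + (1 - t) *: y).
  move=> Ax Ky My.
  have [t t01 tH] := segment_meets_level (Aphi x Ax) (Mphi y My).
  by exists t; do 2 split=> //; apply: (convex_setP K).1 => //; exact: Ax.1.
have [x Ax] := A0.
have slice j : j \in s -> exists2 y, (K `&` H) y &
    forall l, l \in s -> l != j -> M l y.
  move=> js; have [y Ky yM] := allbut1 j (mem_behead (s := i :: s) js).
  have ij : i != j by apply: contraNneq nis => ->.
  have [t [t01 tH]] := crossH x y Ax Ky (yM i (mem_head _ _) ij).
  exists (t *: x + (1 - t) *: y) => // l ls lj.
  apply: (convex_setP (M l)).1 => //; first exact: Ax.2.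
  by apply: yM => //; rewrite inE ls orbT.
have [||||y [Ky Hy] yM] := ih (K `&` H) _ _ _ us _ slice.
- exact: weakly_compactI wK (@level_closed phi a) (@level_convex phi a).
- exact: convex_setI cK (@level_convex phi a).
- by have [y KHy _] := slice k ks; exists y.
- move=> y [Ky Hy]; have [j] := covK y Ky; rewrite inE => /predU1P[->|js Mj].
    by move=> /Mphi; rewrite [sval phi y]Hy ltxx.
  by exists j.
by have /Aphi : A y by []; rewrite [sval phi y]Hy ltxx.
Qed.

(** Induction on the number of points: for the trace of [K] on the closed convex
    hull of [s], the covering hypothesis of Berge's theorem is the one given
    here, since a finite union of closed sets that covers a convex hull covers its
    closure, and the remaining hypothesis is the statement for one point less. *)
Theorem convex_kkm K (M : X -> set X) (s : seq X) :
  weakly_compact K -> @convex_set R X K ->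
  (forall y, closed (M y)) -> (forall y, @convex_set R X (M y)) ->
  (forall r : seq X, {in r, forall y, K y} ->
     forall z, convex_hull [set` r] z -> exists2 y, y \in r & M y z) ->
  s != [::] -> uniq s -> {in s, forall y, K y} ->
  exists2 x, (K `&` closed_convex_hull [set` s]) x & {in s, forall y, M y x}.
Proof.
move=> wK cK clM cM cov.
elim: (size s) {-2}s (erefl (size s)) => [|n ih] {}s sn s0 us sK.
  by rewrite (size0nil sn) in s0.
set D := closed_convex_hull [set` s].
have clD : closed D by exact: closed_closure.
have cD : @convex_set R X D.
  by apply: convex_closure; exact: convex_set_convex_hull.
have sD y : y \in s -> D y.
  by move=> ys; apply: subset_closure; exact: sub_gen_smallest.
have [y0 y0s] : exists y, y \in s.
  by case: s s0 {sn us sK D clD cD sD} => // y s _; exists y; rewrite mem_head.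
apply: berge_intersection => //.
- exact: weakly_compactI.
- exact: convex_setI.
- by exists y0; split; [exact: sK|exact: sD].
- move=> x [_ Dx].
  suff : (\bigcup_(y in [set` s]) M y) x by move=> [y ys]; exists y.
  have clU : closed (\bigcup_(y in [set` s]) M y).
    by apply: closed_bigcup => //; exact: finite_seq.
  apply: clU; move: x Dx; apply: closureS => x /(cov s sK)[y ys Myx].
  by exists y.
- move=> y ys; have [s1|s1] := eqVneq (rem y s) [::].
    exists y; first by split; [exact: sK|exact: sD].
    move=> z zs zy; have : z \in rem y s by rewrite mem_rem_uniq// inE/= zy.
    by rewrite s1.
  have rs z : z \in rem y s -> z \in s by exact: mem_rem.
  have [||||x [Kx Dx] xM] := ih (rem y s).
  + by rewrite size_rem// sn.
  + exact: s1.
  + exact: rem_uniq.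
  + by move=> z /rs; exact: sK.
  exists x; last by move=> z zs zy; apply: xM; rewrite mem_rem_uniq// inE/= zy.
  split=> //; move: x Dx {Kx xM}; apply: closureS.
  by apply: sub_smallest2r; [exact: convex_set_convex_hull|exact: rs].
Qed.

End intersection_theorems.

(** * The regularized bifunction *)

Section regularization.
Variables (R : realType) (X : normedModType R).
Implicit Types (h : X -> \bar R) (K : set X).

Lemma closed_convex_hull_closed (A : set X) : closed (closed_convex_hull A).
Proof. exact: closed_closure. Qed.

Lemma closed_convex_hull_convex (A : set X) :
  @convex_set R X (closed_convex_hull A).
Proof. by apply: convex_closure; exact: convex_set_convex_hull. Qed.

Lemma closed_convex_hullS (A B : set X) :
  A `<=` B -> closed_convex_hull A `<=` closed_convex_hull B.
Proof.
move=> AB; apply: closureS; apply: sub_smallest2r => //.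
exact: convex_set_convex_hull.
Qed.

(** The infimum defining the regularization need not be attained, hence the strict
    inequality; the closed convex hulls of sublevel sets increase with the level. *)
Lemma lsc_quasiconvex_reg_leP h (a : R) (x : X) :
  (lsc_quasiconvex_reg h x <= a%:E)%E <->
  (forall b : R, a < b -> closed_convex_hull (sublevel h b) x).
Proof.
split=> [ha b ab|hb].
  have : (lsc_quasiconvex_reg h x < b%:E)%E.
    by apply: le_lt_trans ha _; rewrite lte_fin.
  move=> /ereal_inf_lt[_ [c /= hc <-]]; rewrite lte_fin => cb.
  move: hc; apply: closed_convex_hullS => y /= hyc.
  by apply: le_trans hyc _; rewrite lee_fin ltW.
apply/lee_addgt0Pr => e e0; apply: ereal_inf_lbound.
by exists (a + e) => //=; apply: hb; rewrite ltrDl.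
Qed.

Lemma bifun_reg_le K (f : X -> X -> R) x y : regularizable K f ->
  K x -> K y -> bifun_reg K f x y <= f x y.
Proof.
move=> freg Kx Ky; rewrite -lee_fin fineK; last exact: freg.
apply/lsc_quasiconvex_reg_leP => b fb; apply: subset_closure.
apply: sub_gen_smallest => /=.
by rewrite /sublevel/= /extend_pinfty mem_set// lee_fin ltW.
Qed.

(** It agrees on [K] with the set [M y] of the introduction.  Taking the hulls in
    the whole space makes it closed whether or not [K] is. *)
Definition nonpos_region K (f : X -> X -> R) (y : X) : set X :=
  \bigcap_(b in [set b : R | 0 < b])
    closed_convex_hull (sublevel (extend_pinfty K (f y)) b).

Lemma nonpos_regionP K (f : X -> X -> R) x y : regularizable K f ->
  K x -> K y -> bifun_reg K f y x <= 0 <-> nonpos_region K f y x.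
Proof.
move=> freg Kx Ky; rewrite -lee_fin fineK; last exact: freg.
exact: lsc_quasiconvex_reg_leP.
Qed.

Lemma nonpos_region_closed K (f : X -> X -> R) y : closed (nonpos_region K f y).
Proof. by apply: closed_bigI => b _; exact: closed_convex_hull_closed. Qed.

Lemma nonpos_region_convex K (f : X -> X -> R) y :
  @convex_set R X (nonpos_region K f y).
Proof.
apply/convex_setP => t x z t01 hx hz b b0.
have /convex_setP :=
  @closed_convex_hull_convex (sublevel (extend_pinfty K (f y)) b).
by apply=> //; [exact: hx|exact: hz].
Qed.

Theorem CFP_nonempty K (f : X -> X -> R) :
  K !=set0 -> @convex_set R X K -> weakly_compact K -> regularizable K f ->
  properly_quasimonotone K (bifun_reg K f) -> CFP (bifun_reg K f) K !=set0.
Proof.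
move=> K0 cK wK freg pqm.
have cover (r : seq X) : {in r, forall y, K y} -> forall z,
    convex_hull [set` r] z -> exists2 y, y \in r & nonpos_region K f y z.
  move=> rK z hz.
  have Kz : K z by move: z hz; apply: smallest_sub.
  have rangeE : range (tnth (in_tuple r)) = [set` r].
    apply/seteqP; split=> [_ [i _ <-]|y /= /seq_tnthP[i ->]].
      exact: mem_tnth.
    by exists i.
  rewrite -rangeE in hz.
  have [i|i yz] := pqm (size r) (tnth (in_tuple r)) _ z hz.
    by apply: rK; exact: mem_tnth.
  exists (tnth (in_tuple r) i); first exact: mem_tnth.
  by apply/nonpos_regionP => //; apply: rK; exact: mem_tnth.
(* The regions are indexed by the points of [K] alone: proper quasimonotonicity
   says nothing about other points. *)
have [i|i|s|x Kx xM] := @weakly_compact_bigcap R X K {y : X | y \in K}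
    (fun i => nonpos_region K f (val i)) wK.
- exact: nonpos_region_closed.
- exact: nonpos_region_convex.
- have [->|s0] := eqVneq s [::]; first by have [x Kx] := K0; exists x.
  have [|||x [Kx _] xM] := @convex_kkm R X K (nonpos_region K f)
      (undup (map val s)) wK cK (@nonpos_region_closed K f)
      (@nonpos_region_convex K f) cover.
  + by apply: contraNneq s0 => /undup_nil; case: s.
  + exact: undup_uniq.
  + by move=> y; rewrite mem_undup => /mapP[i _ ->]; apply: set_mem; exact: valP.
  exists x => // i si; apply: xM; rewrite mem_undup; exact: map_f.
exists x; split=> // y Ky; apply/nonpos_regionP => //.
exact: (xM (exist _ y (mem_set Ky))).
Qed.

Lemma CFP_upper_sign_EP K (g : X -> X -> R) :
  @convex_set R X K -> upper_sign_property K g -> CFP g K `<=` EP g K.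
Proof.
move=> cK us x [Kx xg]; split=> // y Ky; apply: us => // t /andP[t0 t1].
apply: xg; rewrite addrC.
by apply: (convex_setP K).1 => //; rewrite !ltW.
Qed.

End regularization.

Theorem corollary5p1p1 (R : realType) (X : completeNormedModType R)
    (K : set X) (f : X -> X -> R)
    (K_nonempty : K !=set0)
    (K_convex : @convex_set R X K)
    (K_wcompact : weakly_compact K)
    (f_reg : regularizable K f)
    (f_pqm : properly_quasimonotone K (bifun_reg K f)) :
  CFP (bifun_reg K f) K !=set0 /\
  (upper_sign_property K (bifun_reg K f) -> EP f K !=set0).
Proof.
have CFP0 := CFP_nonempty K_nonempty K_convex K_wcompact f_reg f_pqm.
split=> // us; have [x /(CFP_upper_sign_EP K_convex us)[Kx xg]] := CFP0.
exists x; split=> // y Ky.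
exact: le_trans (xg y Ky) (bifun_reg_le f_reg Kx Ky).
Qed.
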